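(* For every $0\le k\le J$, the set of functions $\{\widehat\varphi_{k,i}: x_i\in\mathcal{I}_k\cup\mathcal{M}_k\}$ on $\Omega$ is linearly independent.
   Context: **Grids.** Let $n\in\{1,2,3\}$, let $\Omega\subset\mathbb{R}^n$ be closed and bounded, let $J\ge 0$ be an integer, and let $\Theta_J\subseteq\Theta_{J-1}\subseteq\cdots\subseteq\Theta_0=\Omega$ be closed sets. ''Triangulation'' means a decomposition into closed elements (intervals, triangles, quadrilaterals, tetrahedra, hexahedra, wedges, or mixtures of these). $\mathcal{T}_0$ is a regular (conforming), quasi-uniform triangulation of $\Omega$. For $k=1,\dots,J$, $\Theta_k$ is a union of elements of $\mathcal{T}_{k-1}$, and $\mathcal{T}_k$ is obtained from $\mathcal{T}_{k-1}$ by midpoint refinement of only those elements of $\mathcal{T}_{k-1}$ that lie on $\Theta_k$. No bound on the difference of refinement levels of adjacent elements is imposed. For $0\le l\le k\le J$ set $\Omega_k^l=\overline{\Theta_l\setminus\Theta_{l+1}}$ if $l<k$, $\Omega_k^k=\Theta_k$, and $\Omega_{k,l}=\bigcup_{m=0}^l\Omega_k^m$ (so $\Omega_{k,k}=\Omega$). $\mathcal{T}_k^l$ is the set of elements $T\in\mathcal{T}_k$ with $T\cap \mathrm{int}(\Omega_k^l)\ne\emptyset$; it is a regular triangulation of $\Omega_k^l$. Put $\mathcal{E}_k^0=\Omega_{k,0}$ and $\mathcal{E}_k^l=\Omega_{k,l}\setminus\Omega_{k,l-1}$ for $1\le l\le k$; these sets are pairwise disjoint with union $\Omega$. **Discontinuous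 basis.** Fix a Lagrangian finite element family with polynomial space $\mathcal{P}_r$ of degree $r$ (e.g. linear, bi/trilinear, quadratic, bi/triquadratic), and let $V_k^l=\{v\in H^1(\Omega_k^l): v|_T\in\mathcal{P}_r\ \forall T\in\mathcal{T}_k^l\}$ (continuous functions on $\Omega_k^l$). $X_k^l$ is the set of Lagrange nodal points of $\mathcal{T}_k^l$, and $X_k=\bigcup_{l=0}^kX_k^l=\{x_1,\dots,x_{N_k}\}$. For $x_i\in X_k^l$, $\varphi_{k,i}^l:\Omega_k^l\to\mathbb{R}$ is the standard Lagrange nodal basis function of $V_k^l$ at $x_i$, so $\varphi_{k,i}^l(x_j)=\delta_{ij}$ for all $x_j\in X_k^l$. For $x_i\in X_k$ and $x\in\Omega$, with $\gamma$ the unique index such that $x\in\mathcal{E}_k^\gamma$, define $\varphi_{k,i}(x)=\varphi_{k,i}^\gamma(x)$ if $x_i\in X_k^\gamma$ and $\varphi_{k,i}(x)=0$ otherwise. **Node types.** $\mathcal{H}_k=\{x_i\in X_k:\varphi_{k,j}(x_i)\neq0\text{ for some }x_j\in X_k,\ x_j\ne x_i\}$ (hanging nodes); $\mathcal{M}_k=\{x_i\in X_k\setminus\mathcal{H}_k:\varphi_{k,i}(x_j)\ne0\text{ for some }x_j\in\mathcal{H}_k\}$ (master nodes); $\mathcal{I}_k=X_k\setminus(\mathcal{M}_k\cup\mathcal{H}_k)$ (interior nodes). **Descendants.** A node $x_j\neq x_i$ is a child of $x_i$ if $\varphi_{k,i}(x_j)\ne0$. For a node $y$ let $\mathcal{H}^1_y$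 be the set of children of $y$. Let $x_i\in\mathcal{M}_k$. Put $\beta_0^{max}=1$, $x_{i,1}^0=x_i$; for $\alpha\ge1$ let $\{x_{i,\beta}^\alpha\}_{\beta=1}^{\beta_\alpha^{max}}$ be the sequence, with repetition, listing all children of $x_{i,1}^{\alpha-1}$, then all children of $x_{i,2}^{\alpha-1}$, and so on up to $x_{i,\beta_{\alpha-1}^{max}}^{\alpha-1}$. For $\alpha\ge1$ and $1\le\beta\le\beta_{\alpha-1}^{max}$ let $\mathcal{H}_{x_i}^{\alpha,\beta}=\mathcal{H}^1_{x_{i,\beta}^{\alpha-1}}$. A node $x_j$ regarded as an element of $\mathcal{H}_{x_i}^{\alpha,\beta}$ has an ancestor sequence $x_{j_0}=x_i,x_{j_1},\dots,x_{j_\alpha}=x_j$, where $x_{j_m}=x_{i,\beta_{j_m}}^m$, $\beta_{j_0}=1$, $\beta_{j_{\alpha-1}}=\beta$, and $x_{j_{m+1}}$ is the occurrence listed as a child of the entry $x_{i,\beta_{j_m}}^{m}$ (so $x_{j_{m+1}}\in\mathcal{H}_{x_i}^{m+1,\beta_{j_m}}$). For $\alpha\ge2$ put $U_{x_i,x_j}^{\alpha,\beta}=\bigcup_{m=1}^{\alpha-1}\mathcal{H}_{x_i}^{\alpha-m,\beta_{j_{\alpha-m-1}}}$ and $S_{x_i,x_j}^{\alpha,\beta}=\{x_{j_\gamma}:2\le\gamma\le\alpha,\ x_{j_\gamma}\in U_{x_i,x_{j_\gamma}}^{\gamma,\beta_{j_{\gamma-1}}}\}$, where $x_{j_\gamma}$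 is regarded as an element of $\mathcal{H}_{x_i}^{\gamma,\beta_{j_{\gamma-1}}}$ with ancestors $x_{j_0},\dots,x_{j_\gamma}$. Let $\widetilde{\mathcal{H}}_{x_i}^{1,1}=\mathcal{H}_{x_i}^{1,1}$ and, for $\alpha\ge2$, $\widetilde{\mathcal{H}}_{x_i}^{\alpha,\beta}=\{x_j\in\mathcal{H}_{x_i}^{\alpha,\beta}:S_{x_i,x_j}^{\alpha,\beta}=\emptyset\}$. Let $\alpha_i^{max}$ be the largest $\alpha$ with $\widetilde{\mathcal{H}}_{x_i}^{\alpha,\beta}\neq\emptyset$ for some $\beta\in\{1,\dots,\beta_{\alpha-1}^{max}\}$. **Modified functions.** Define $\widehat\varphi_{k,i}=\varphi_{k,i}$ if $x_i\in\mathcal{I}_k$; $\widehat\varphi_{k,i}=0$ if $x_i\in\mathcal{H}_k$; and, if $x_i\in\mathcal{M}_k$, $$\widehat\varphi_{k,i}=\varphi_{k,i}+\sum_{\alpha=1}^{\alpha_i^{max}}\sum_{\beta=1}^{\beta_{\alpha-1}^{max}}\ \sum_{j:\,x_j\in\widetilde{\mathcal{H}}_{x_i}^{\alpha,\beta}}\Big(\prod_{m=1}^{\alpha}\varphi_{k,j_{m-1}}(x_{j_m})\Big)\varphi_{k,j},$$ where $\varphi_{k,j_m}$ denotes the function associated with the node $x_{j_m}$ of the ancestor sequence of $x_j\in\mathcal{H}_{x_i}^{\alpha,\beta}$. *)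

(* Defs.v *)
From mathcomp Require Import all_boot all_order all_algebra.
From mathcomp Require Import all_classical all_reals all_analysis.

Set Implicit Arguments.
Unset Strict Implicit.
Unset Printing Implicit Defensive.

Import Order.TTheory GRing.Theory Num.Theory.
Import numFieldNormedType.Exports.

Local Open Scope classical_set_scope.
Local Open Scope ring_scope.

Inductive cell_type : Type :=
  Interval | Triangle | Quadrilateral | Tetrahedron | Hexahedron | Wedge.

Definition cell_dim (s : cell_type) : nat :=
  match s with
  | Interval => 1
  | Triangle | Quadrilateral => 2
  | Tetrahedron | Hexahedron | Wedge => 3
  end.

(* Reference coordinates of every cell type live in R^3; the coordinates
   beyond the dimension of the cell are zero. *)
Definition refpt (R : realType) : Type := (R * R * R)%type.

Definition ref_cell (R : realType) (s : cell_type) : set (refpt R) :=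
  [set p | let: (x, y, z) := p in
    match s with
    | Interval => [/\ 0 <= x <= 1, y = 0 & z = 0]
    | Triangle => [/\ 0 <= x, 0 <= y, x + y <= 1 & z = 0]
    | Quadrilateral => [/\ 0 <= x <= 1, 0 <= y <= 1 & z = 0]
    | Tetrahedron => [/\ 0 <= x, 0 <= y, 0 <= z & x + y + z <= 1]
    | Hexahedron => [/\ 0 <= x <= 1, 0 <= y <= 1 & 0 <= z <= 1]
    | Wedge => [/\ 0 <= x, 0 <= y, x + y <= 1 & 0 <= z <= 1]
    end].

Definition ref_vertices (R : realType) (s : cell_type) : seq (refpt R) :=
  match s with
  | Interval => [:: (0, 0, 0); (1, 0, 0)]
  | Triangle => [:: (0, 0, 0); (1, 0, 0); (0, 1, 0)]
  | Quadrilateral => [:: (0, 0, 0); (1, 0, 0); (0, 1, 0); (1, 1, 0)]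
  | Tetrahedron => [:: (0, 0, 0); (1, 0, 0); (0, 1, 0); (0, 0, 1)]
  | Hexahedron => [:: (0, 0, 0); (1, 0, 0); (0, 1, 0); (1, 1, 0);
                      (0, 0, 1); (1, 0, 1); (0, 1, 1); (1, 1, 1)]
  | Wedge => [:: (0, 0, 0); (1, 0, 0); (0, 1, 0);
                 (0, 0, 1); (1, 0, 1); (0, 1, 1)]
  end.

(* The (multi)linear vertex functions, in the order of [ref_vertices]: the
   barycentric coordinates of a simplex, and products of those for the other
   cells. *)
Definition vertex_weights (R : realType) (s : cell_type) (p : refpt R) :
    seq R :=
  let: (x, y, z) := p in
  let lin t := [:: 1 - t; t] in
  let tri := [:: 1 - x - y; x; y] in
  let quad := [seq b * a | b <- lin y, a <- lin x] in
  match s with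
  | Interval => lin x
  | Triangle => tri
  | Quadrilateral => quad
  | Tetrahedron => [:: 1 - x - y - z; x; y; z]
  | Hexahedron => [seq c * a | c <- lin z, a <- quad]
  | Wedge => [seq c * a | c <- lin z, a <- tri]
  end.

(* The faces (of any dimension) of a convex polytope are the sets of maximizers
   of linear functionals; the zero functional gives the cell itself. *)
Definition ref_face (R : realType) (s : cell_type) (a : refpt R) :
    set (refpt R) :=
  let pairing (p : refpt R) := a.1.1 * p.1.1 + a.1.2 * p.1.2 + a.2 * p.2 in
  [set p | ref_cell s p /\ forall q, ref_cell s q -> pairing q <= pairing p].

Record element (R : realType) (n : nat) : Type := Element {
  el_type : cell_type;
  el_vertices : seq 'rV[R]_n
}.

(* The (multi)linear map taking the reference vertices to the vertices of T. *)
Definition geom_map (R : realType) (n : nat) (T : element R n) (p : refpt R) :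
    'rV[R]_n :=
  \sum_(c <- zip (vertex_weights (el_type T) p) (el_vertices T)) c.1 *: c.2.

Definition el_set (R : realType) (n : nat) (T : element R n) : set 'rV[R]_n :=
  geom_map T @` ref_cell (el_type T).

(* The lower Lipschitz bound says that the (multi)linear map is injective on
   the closed reference cell, with invertible Jacobian there. For simplices
   this is affine independence of the vertices. *)
Definition nondegenerate (R : realType) (n : nat) (T : element R n) : Prop :=
  [/\ cell_dim (el_type T) = n,
      size (el_vertices T) = size (ref_vertices R (el_type T)) &
      exists2 c : R, 0 < c &
        forall p q, ref_cell (el_type T) p -> ref_cell (el_type T) q ->
          c * `|p - q| <= `|geom_map T p - geom_map T q|].

Definition proper_face (R : realType) (n : nat) (T : element R n)
    (A : set 'rV[R]_n) : Prop :=
  exists2 a : refpt R, ref_face (el_type T) a <> ref_cell (el_type T) &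
    A = geom_map T @` ref_face (el_type T) a.

Definition covered (R : realType) (n : nat) (S : set (element R n)) :
    set 'rV[R]_n :=
  \bigcup_(T in S) el_set T.

Definition regular_triangulation (R : realType) (n : nat)
    (Omega : set 'rV[R]_n) (S : set (element R n)) : Prop :=
  [/\ finite_set S,
      forall T, S T -> nondegenerate T,
      covered S = Omega &
      forall T T', S T -> S T' -> T <> T' ->
        el_set T `&` el_set T' = set0 \/
        (proper_face T (el_set T `&` el_set T') /\
         proper_face T' (el_set T `&` el_set T'))].

Definition diameter (R : realType) (n : nat) (A : set 'rV[R]_n) : R :=
  sup [set `|x - y| | x in A & y in A].

(* Every element contains a ball whose radius is comparable with the largest
   element diameter. Distances are measured in the maximum norm of 'rV[R]_n,
   which only affects the constant c. *)
Definition quasi_uniform (R : realType) (n : nat) (S : set (element R n)) :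
    Prop :=
  exists2 c : R, 0 < c & forall T T', S T -> S T' ->
    exists y, ball y (c * diameter (el_set T')) `<=` el_set T.

Definition midpoint (R : realType) (p q : refpt R) : refpt R :=
  ((p.1.1 + q.1.1) / 2, (p.1.2 + q.1.2) / 2, (p.2 + q.2) / 2).

(* Vertices of the cells of the midpoint subdivision of a reference cell: one
   half-sized copy of the cell at each of its vertices, and, for triangles,
   wedges and tetrahedra, the cells filling the rest. For a tetrahedron the
   rest is an octahedron, which is cut into four along one of its three
   diagonals, selected by d. *)
Definition ref_children (R : realType) (d : 'I_3) (s : cell_type) :
    seq (seq (refpt R)) :=
  let v i : refpt R := nth (0, 0, 0) (ref_vertices R s) i in
  let m i j := midpoint (v i) (v j) in
  let corners := [seq [seq midpoint a b | b <- ref_vertices R s]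
                     | a <- ref_vertices R s] in
  let octahedron a b c :=
    let p := m 0%N a in let q := m b c in
    [:: [:: p; q; m 0%N b; m 0%N c]; [:: p; q; m 0%N c; m a c];
        [:: p; q; m a c; m a b];     [:: p; q; m a b; m 0%N b]] in
  corners ++
  match s with
  | Interval | Quadrilateral | Hexahedron => [::]
  | Triangle => [:: [:: m 1 2; m 0 2; m 0 1]]%N
  | Wedge =>
      let bottom := [:: m 1 2; m 0 2; m 0 1]%N in
      let top := [:: m 4 5; m 3 5; m 3 4]%N in
      let middle := [seq midpoint pq.1 pq.2 | pq <- zip bottom top] in
      [:: bottom ++ middle; middle ++ top]
  | Tetrahedron =>
      nth [::] [:: octahedron 1 2 3; octahedron 2 1 3; octahedron 3 1 2]%N d
  end.

Definition children (R : realType) (n : nat) (d : 'I_3) (T : element R n) :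
    set (element R n) :=
  [set C | exists2 vs, vs \in ref_children R d (el_type T) &
           C = Element (el_type T) (map (geom_map T) vs)].

(* S' arises from S by midpoint refinement of exactly the elements lying on
   Theta; the octahedron diagonals are arbitrary. *)
Definition midpoint_refinement (R : realType) (n : nat)
    (Theta : set 'rV[R]_n) (S S' : set (element R n)) : Prop :=
  exists d : element R n -> 'I_3,
    S' = [set T | S T /\ ~ el_set T `<=` Theta] `|`
         \bigcup_(T in [set T | S T /\ el_set T `<=` Theta]) children (d T) T.

Record refined_grid (R : realType) (n : nat) (Omega : set 'rV[R]_n) (J : nat)
    (Theta : nat -> set 'rV[R]_n) (Tri : nat -> set (element R n)) : Prop := {
  rg_closed : closed Omega;
  rg_bounded : bounded_set Omega;
  rg_Theta0 : Theta 0%N = Omega;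
  rg_Theta_closed : forall k, (k <= J)%N -> closed (Theta k);
  rg_Theta_sub : forall k, (k < J)%N -> Theta k.+1 `<=` Theta k;
  rg_regular : regular_triangulation Omega (Tri 0%N);
  rg_quasi_uniform : quasi_uniform (Tri 0%N);
  rg_Theta_union : forall k, (k < J)%N ->
    exists2 S, S `<=` Tri k & Theta k.+1 = covered S;
  rg_refine : forall k, (k < J)%N ->
    midpoint_refinement (Theta k.+1) (Tri k) (Tri k.+1)
}.

Section Levels.
Variables (R : realType) (n : nat).
Implicit Types (Theta : nat -> set 'rV[R]_n) (Tri : nat -> set (element R n)).

(* Omega_k^l *)
Definition Omega_lev Theta (k l : nat) : set 'rV[R]_n :=
  if (l < k)%N then closure (Theta l `\` Theta l.+1) else Theta k.

(* Omega_{k,l} *)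
Definition Omega_upto Theta (k l : nat) : set 'rV[R]_n :=
  \bigcup_(m in [set m | (m <= l)%N]) Omega_lev Theta k m.

(* E_k^l *)
Definition E_lev Theta (k l : nat) : set 'rV[R]_n :=
  if l is l'.+1 then Omega_upto Theta k l `\` Omega_upto Theta k l'
  else Omega_upto Theta k 0.

(* T_k^l *)
Definition Tri_lev Theta Tri (k l : nat) : set (element R n) :=
  [set T | Tri k T /\ el_set T `&` interior (Omega_lev Theta k l) !=set0].

End Levels.

Definition poly3 (R : realType) (r : nat) (c : nat -> nat -> nat -> R)
    (p : refpt R) : R :=
  \sum_(i < r.+1) \sum_(j < r.+1) \sum_(l < r.+1)
    c i j l * p.1.1 ^+ i * p.1.2 ^+ j * p.2 ^+ l.

(* A Lagrange element in the sense of Ciarlet on each reference cell. Degree r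
   means that the local space contains the polynomials of total degree <= r
   and consists of polynomials of degree <= r in each variable, as do P_r on
   simplices, Q_r on quadrilaterals and hexahedra, and the product of P_r in
   (x, y) and P_r in z on wedges. *)
Record lagrange_family (R : realType) (r : nat) : Type := LagrangeFamily {
  lf_space : cell_type -> set (refpt R -> R);
  lf_nodes : cell_type -> seq (refpt R);
  lf_linear : forall s (a : R) p q, lf_space s p -> lf_space s q ->
    lf_space s (fun x => a * p x + q x);
  lf_total_degree : forall s c,
    (forall i j l, (r < i + j + l)%N -> c i j l = 0) ->
    lf_space s (poly3 r c);
  lf_polynomial : forall s p, lf_space s p ->
    exists c, forall x, ref_cell s x -> p x = poly3 r c x;
  lf_nodes_in : forall s a, a \in lf_nodes s -> ref_cell s a;
  lf_interpolates : forall s (w : refpt R -> R),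
    exists2 p, lf_space s p & forall a, a \in lf_nodes s -> p a = w a;
  lf_unisolvent : forall s p, lf_space s p ->
    (forall a, a \in lf_nodes s -> p a = 0) ->
    forall x, ref_cell s x -> p x = 0
}.

Section Nodes.
Variables (R : realType) (r n : nat) (F : lagrange_family R r).
Variables (Theta : nat -> set 'rV[R]_n) (Tri : nat -> set (element R n)).

(* v|_T belongs to the local space, transported from the reference cell by
   [geom_map]; for affine T this is the same as using coordinates on T. *)
Definition in_local_space (T : element R n) (v : 'rV[R]_n -> R) : Prop :=
  exists2 p, lf_space F (el_type T) p &
    forall x, ref_cell (el_type T) x -> v (geom_map T x) = p x.

(* V_k^l; the members are total functions, used only on Omega_k^l. A function
   that is continuous and piecewise polynomial is in H^1. *)
Definition V_lev (k l : nat) : set ('rV[R]_n -> R) :=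
  [set v | {within Omega_lev Theta k l, continuous v} /\
           forall T, Tri_lev Theta Tri k l T -> in_local_space T v].

(* X_k^l *)
Definition X_lev (k l : nat) : set 'rV[R]_n :=
  \bigcup_(T in Tri_lev Theta Tri k l)
    geom_map T @` [set` lf_nodes F (el_type T)].

(* X_k *)
Definition X_all (k : nat) : set 'rV[R]_n :=
  \bigcup_(l in [set l | (l <= k)%N]) X_lev k l.

Definition nodal_basis_function (k l : nat) (y : 'rV[R]_n)
    (v : 'rV[R]_n -> R) : Prop :=
  V_lev k l v /\ forall z, X_lev k l z -> v z = (z == y)%:R.

(* The unique gamma <= k such that y is in E_k^gamma, for y in Omega. *)
Definition level_of (k : nat) (y : 'rV[R]_n) : nat :=
  xget 0%N [set g | (g <= k)%N /\ E_lev Theta k g y].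

(* phi_{k,i}, from the node x = x_i and its functions phi l = phi_{k,i}^l. *)
Definition disc_basis (k : nat) (x : 'rV[R]_n) (phi : nat -> 'rV[R]_n -> R)
    (y : 'rV[R]_n) : R :=
  if `[< X_lev k (level_of k y) x >] then phi (level_of k y) y else 0.

End Nodes.

(* Here ph i is the function phi_{k,i} attached to the node x i; since the
   enumeration x of X_k is injective, nodes are referred to by their indices. *)
Section Modified.
Variables (R : realType) (n N : nat).
Variables (x : 'I_N -> 'rV[R]_n) (ph : 'I_N -> 'rV[R]_n -> R).
Implicit Types (i j : 'I_N) (s : seq 'I_N).

Definition hanging i : bool := [exists j, (j != i) && (ph j (x i) != 0)].

Definition master i : bool :=
  ~~ hanging i && [exists j, hanging j && (ph i (x j) != 0)].

Definition inner i : bool := ~~ (master i || hanging i).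

(* H^1_{x_i} *)
Definition node_children i : seq 'I_N :=
  [seq j <- enum 'I_N | (j != i) && (ph i (x j) != 0)].

(* The a-th sequence x_{i,1}^a, x_{i,2}^a, ... of descendants; every entry is
   stored as its ancestor sequence [:: j_0; ...; j_a], the entry itself being
   the last term. Positions b count from 0. *)
Fixpoint descendants i (a : nat) : seq (seq 'I_N) :=
  if a is a'.+1 then
    flatten [seq [seq rcons s j | j <- node_children (last i s)]
                | s <- descendants i a']
  else [:: [:: i]].

(* The ancestor sequence of x_{i,b}^a *)
Definition entry i (a b : nat) : seq 'I_N := nth [::] (descendants i a) b.

(* H_{x_i}^{a,b} *)
Definition H_set i (a b : nat) : seq 'I_N :=
  node_children (last i (entry i a.-1 b)).

(* The ancestor sequence of x_j as an element of H_{x_i}^{a,b} *)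
Definition ancestors i (a b : nat) j : seq 'I_N := rcons (entry i a.-1 b) j.

(* Membership in U for an element with ancestor sequence s = (j_0, ..., j_g):
   H_{x_i}^{g-m, beta_{j_{g-m-1}}} is the set of children of x_{j_{g-m-1}}. *)
Definition in_U i s (g : nat) : bool :=
  has (fun m => nth i s g \in node_children (nth i s (g - m - 1)))
      (iota 1 g.-1).

(* The set S, for an element with ancestor sequence s = (j_0, ..., j_a) *)
Definition S_set i s (a : nat) : seq 'I_N :=
  [seq nth i s g | g <- iota 2 a.-1 & in_U i s g].

(* H~_{x_i}^{a,b}; for a = 1 the set S is empty *)
Definition Htilde i (a b : nat) : seq 'I_N :=
  [seq j <- H_set i a b | nilp (S_set i (ancestors i a b j) a)].

Definition nonempty_level i (a : nat) : Prop :=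
  (1 <= a)%N /\
  exists2 b, (b < size (descendants i a.-1))%N & Htilde i a b <> [::].

(* The largest a such that some H~_{x_i}^{a,b} is nonempty. It exists for a
   master node: the indices j_1, ..., j_a of an ancestor sequence with empty S
   are pairwise distinct, so a <= N. *)
Definition alpha_max i : nat :=
  xget 0%N [set a | nonempty_level i a /\
                    forall a', nonempty_level i a' -> (a' <= a)%N].

Definition modified i (y : 'rV[R]_n) : R :=
  if inner i then ph i y
  else if hanging i then 0
  else ph i y +
    \sum_(1 <= a < (alpha_max i).+1)
    \sum_(0 <= b < size (descendants i a.-1))
    \sum_(j <- Htilde i a b)
      (\prod_(1 <= m < a.+1)
         ph (nth i (ancestors i a b j) m.-1)
            (x (nth i (ancestors i a b j) m))) * ph j y.

End Modified.

(* Main.v *)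
Require Import Defs.
From HB Require Import structures.
From mathcomp Require Import all_boot all_order all_algebra.
From mathcomp Require Import all_classical all_reals all_analysis.
From mathcomp Require Import ring lra.
Set Implicit Arguments.
Unset Strict Implicit.
Unset Printing Implicit Defensive.
Import Order.TTheory GRing.Theory Num.Theory.
Import numFieldNormedType.Exports.
Local Open Scope classical_set_scope.
Local Open Scope ring_scope.

(** Evaluate a vanishing combination of the modified functions at a node x_i
    that is not hanging. By the definition of a hanging node every phi_j with
    j <> i vanishes at x_i. The correction terms of a modified function are
    multiples of functions phi_j whose node x_j is a child of another node, so
    x_j is hanging and differs from x_i; they vanish at x_i as well
    ([modified_nonhanging]). Only the term c_i * phi_i(x_i) survives, and the
    theorem is reduced to phi_i(x_i) = 1 ([disc_basis_nonhanging]).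

    The value phi_i(x_i) is read off on the level g that x_i belongs to as a
    point. If x_i is a node of that level, the value is 1. Otherwise every
    phi_j would vanish at x_i, whereas the nodal functions of level g add up
    to 1 on the whole of Omega_k^g ([sum_nodal_basis]): this follows from
    unisolvence on any element of T_k^g containing the point, because the
    constant 1 belongs to the local space.

    That such an element exists ([Tri_lev_covers]) is the geometric part. A
    point of the closure of Theta_g minus Theta_{g+1} lies in one of the
    finitely many closed elements of T_g that lie on Theta_g but not on
    Theta_{g+1}; these are never refined and survive in T_k. For g = k, the
    elements of T_k on Theta_k take their place. To belong to T_k^g, such an
    element must meet the interior of Omega_k^g, and this holds because an
    element is the closure of its interior ([el_set_interior]). For multilinear
    elements the last fact is a local surjectivity statement: the element map
    is strictly differentiable and has a lower Lipschitz bound, hence it is open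
    near each point of the open reference cell ([strict_open_map], by the
    contraction principle). All of this is inherited by the elements of every
    T_k because a midpoint child is a nondegenerate part of its parent
    ([children_nondegenerate]) and the children cover it ([children_cover]). *)

(** * Strict differentiability and local surjectivity *)

(** Joins the norm and the completeness of row vectors, which
    [banach_fixed_point] needs as one structure. *)
HB.instance Definition _ (R : realType) (n : nat) := Complete.on 'rV[R]_n.

Section StrictDiff.
Variables (R : realType) (n : nat).
Implicit Types (V : normedModType R) (p u v : 'rV[R]_n).

(** The strong (two-point) form of the derivative: it makes f minus its linear
    part a contraction near p without any mean value inequality, and it passes
    to products, so that it can be read off from polynomial formulas. *)
Definition strict_deriv V (f : 'rV[R]_n -> V) p (L : 'rV[R]_n -> V) : Prop :=
  [/\ forall a u v, L (a *: u + v) = a *: L u + L v,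
      exists C : R, forall u, `|L u| <= C * `|u| &
      forall e : R, 0 < e -> exists2 d : R, 0 < d &
        forall u v, `|u - p| <= d -> `|v - p| <= d ->
          `|f u - f v - L (u - v)| <= e * `|u - v|].

Definition strictly_differentiable V (f : 'rV[R]_n -> V) p : Prop :=
  exists L, strict_deriv f p L.

Lemma sdiff_cst V (a : V) p : strictly_differentiable (fun=> a) p.
Proof.
exists (fun=> 0); split => [b u v||e e0]; first by rewrite scaler0 addr0.
  by exists 0 => u; rewrite normr0 mul0r.
by exists 1 => // u v _ _; rewrite !subrr normr0 mulr_ge0// ltW.
Qed.

Lemma sdiffD V (f g : 'rV[R]_n -> V) p :
  strictly_differentiable f p -> strictly_differentiable g p ->
  strictly_differentiable (fun u => f u + g u) p.
Proof.
move=> [L [Ll [C LC] Lf]] [M [Ml [D MD] Mg]].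
exists (fun u => L u + M u); split=> [a u v||e e0].
- by rewrite Ll Ml scalerDr addrACA.
- exists (C + D) => u; rewrite mulrDl.
  by rewrite (le_trans (ler_normD _ _))// lerD.
have e2 : 0 < e / 2 by rewrite divr_gt0.
have [d d0 Hd] := Lf _ e2; have [d' d0' Hd'] := Mg _ e2.
exists (Num.min d d'); first by rewrite lt_min d0.
move=> u v; rewrite !le_min => /andP[u1 u2] /andP[v1 v2].
have -> : f u + g u - (f v + g v) - (L (u - v) + M (u - v)) =
  (f u - f v - L (u - v)) + (g u - g v - M (u - v)).
  by rewrite !opprD (addrACA (f u)) [LHS]addrACA.
rewrite (le_trans (ler_normD _ _))//.
have := Hd u v u1 v1; have := Hd' u v u2 v2; lra.
Qed.

Lemma sdiff_lipschitz V (f : 'rV[R]_n -> V) p :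
  strictly_differentiable f p ->
  exists2 K : R, 0 < K & exists2 d : R, 0 < d &
    forall u v, `|u - p| <= d -> `|v - p| <= d ->
      `|f u - f v| <= K * `|u - v|.
Proof.
move=> [L [Ll [C LC] Lf]]; have [d d0 Hd] := Lf 1 ltr01.
exists (`|C| + 1); first by rewrite ltr_wpDl.
exists d => // u v ud vd.
rewrite -(subrK (L (u - v)) (f u - f v)) (le_trans (ler_normD _ _))//.
rewrite mulrDl addrC lerD ?Hd//.
by rewrite (le_trans (LC _))// ler_wpM2r// ler_norm.
Qed.

(** The product rule comes from
    a(u) f(u) - a(v) f(v) - (L h f(p) + a(p) M h)
      = a(u) (f(u) - f(v) - M h) + (a(u) - a(p)) M h
        + (a(u) - a(v) - L h) f(v) + L h (f(v) - f(p)), with h = u - v,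
    where each of the four terms is made smaller than e / 4 * |h|. *)
Lemma sdiffZ V (a : 'rV[R]_n -> R^o) (f : 'rV[R]_n -> V) p :
  strictly_differentiable a p -> strictly_differentiable f p ->
  strictly_differentiable (fun u => a u *: f u) p.
Proof.
move=> sa sf; have [K K0 [d1 d10 Ka]] := sdiff_lipschitz sa.
have [K' K'0 [d2 d20 Kf]] := sdiff_lipschitz sf.
move: sa sf => [L [Ll [C LC] La]] [M [Ml [D MD] Mf]].
exists (fun u => L u *: f p + a p *: M u); split=> [b u v||e e0].
- rewrite Ll Ml !scalerDr scalerDl -!scalerA !scalerA (mulrC b (a p)).
  by rewrite addrACA.
- exists (C * `|f p| + `|a p| * D) => u; rewrite mulrDl.
  rewrite (le_trans (ler_normD _ _))// lerD// normrZ.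
    by rewrite mulrAC ler_wpM2r.
  by rewrite -mulrA ler_wpM2l.
pose A := `|a p| + 1; pose B := `|f p| + 1.
have A0 : 0 < A by rewrite ltr_wpDl.
have B0 : 0 < B by rewrite ltr_wpDl.
have [d3 d30 H3] := La (e / 4 / B) ltac:(by rewrite !divr_gt0).
have [d4 d40 H4] := Mf (e / 4 / A) ltac:(by rewrite !divr_gt0).
pose d5 := K^-1; pose d6 := K'^-1.
pose D' := `|D| + 1; pose C' := `|C| + 1.
have D0 : 0 < D' by rewrite ltr_wpDl.
have C0 : 0 < C' by rewrite ltr_wpDl.
pose d7 := e / 4 / K / D'; pose d8 := e / 4 / K' / C'.
exists (\big[Num.min/1]_(x <- [:: d1; d2; d3; d4; d5; d6; d7; d8]) x).
  rewrite !big_cons big_nil !lt_min d10 d20 d30 d40 /d5 /d6 /d7 /d8.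
  by rewrite !invr_gt0 K0 K'0 !divr_gt0// ltr01.
rewrite !big_cons big_nil => u v; rewrite !le_min.
move=> /and5P[u1 u2 u3 u4 /and5P[u5 u6 u7 u8 _]].
move=> /and5P[v1 v2 v3 v4 /and5P[v5 v6 v7 v8 _]].
have -> : a u *: f u - a v *: f v - (L (u - v) *: f p + a p *: M (u - v)) =
  (a u *: (f u - f v - M (u - v)) + (a u - a p) *: M (u - v)) +
  ((a u - a v - L (u - v)) *: f v + L (u - v) *: (f v - f p)).
  rewrite !scalerBr !scalerBl subrKA subrKA [RHS]addrACA subrKA opprD.
  by rewrite (addrC (- (a p *: _))).
have nA : `|a u| <= A.
  rewrite -(subrK (a p) (a u)) (le_trans (ler_normD _ _))// addrC lerD2l.
  have := Ka u p u1; rewrite subrr normr0 => /(_ (ltW d10)) /le_trans; apply.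
  by rewrite -(mulfV (lt0r_neq0 K0)) ler_pM2l.
have nB : `|f v| <= B.
  rewrite -(subrK (f p) (f v)) (le_trans (ler_normD _ _))// addrC lerD2l.
  have := Kf v p v2; rewrite subrr normr0 => /(_ (ltW d20)) /le_trans; apply.
  by rewrite -(mulfV (lt0r_neq0 K'0)) ler_pM2l.
have t1 : `|a u *: (f u - f v - M (u - v))| <= e / 4 * `|u - v|.
  rewrite normrZ; apply: (@le_trans _ _ (A * (e / 4 / A * `|u - v|))).
    by rewrite ler_pM// H4.
  by rewrite mulrA (mulrC A) divfK// lt0r_neq0.
have t3 : `|(a u - a v - L (u - v)) *: f v| <= e / 4 * `|u - v|.
  rewrite normrZ; apply: (@le_trans _ _ (e / 4 / B * `|u - v| * B)).
    by rewrite ler_pM// H3.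
  by rewrite mulrAC divfK// lt0r_neq0.
have t2 : `|(a u - a p) *: M (u - v)| <= e / 4 * `|u - v|.
  rewrite normrZ; apply: (@le_trans _ _ (K * d7 * (D' * `|u - v|))).
    apply: ler_pM => //.
      apply: le_trans (Ka _ _ u1 _) _; first by rewrite subrr normr0 ltW.
      by rewrite ler_pM2l.
    apply: le_trans (MD _) _; rewrite ler_wpM2r//.
    by rewrite (le_trans (ler_norm _))// lerDl.
  by rewrite le_eqVlt /d7; apply/orP; left; apply/eqP; field; rewrite !lt0r_neq0.
have t4 : `|L (u - v) *: (f v - f p)| <= e / 4 * `|u - v|.
  rewrite normrZ; apply: (@le_trans _ _ (C' * `|u - v| * (K' * d8))).
    apply: ler_pM => //.
      apply: le_trans (LC _) _; rewrite ler_wpM2r//.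
      by rewrite (le_trans (ler_norm _))// lerDl.
    apply: le_trans (Kf _ _ v2 _) _; first by rewrite subrr normr0 ltW.
    by rewrite ler_pM2l.
  by rewrite le_eqVlt /d8; apply/orP; left; apply/eqP; field; rewrite !lt0r_neq0.
rewrite (le_trans (ler_normD _ _))// .
have := ler_normD (a u *: (f u - f v - M (u - v))) ((a u - a p) *: M (u - v)).
have := ler_normD ((a u - a v - L (u - v)) *: f v) (L (u - v) *: (f v - f p)).
lra.
Qed.

Lemma norm_row_coord p j : `|p 0 j| <= `|p|.
Proof.
rewrite [leRHS]/Num.norm /= mx_normrE; apply/bigmax_geP; right => /=.
by exists (0, j).
Qed.

Lemma sdiff_coord p j : strictly_differentiable (fun u => u 0 j : R^o) p.
Proof.
exists (fun u => u 0 j); split=> [a u v||e e0]; first by rewrite !mxE.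
  by exists 1 => u; rewrite mul1r norm_row_coord.
exists 1 => // u v _ _; rewrite !mxE subrr normr0.
by rewrite mulr_ge0// ltW.
Qed.

(** The lower Lipschitz bound passes to the derivative M of f at p, so M is
    invertible; for y close to f p, a solution of f u = y is a fixed point of
    the quasi-Newton map u - (f u - y) M^-1, which is a contraction. *)
Lemma strict_open_map (f : 'rV[R]_n -> 'rV[R]_n) p (r c : R) :
  0 < r -> 0 < c ->
  (forall u v, `|u - p| <= r -> `|v - p| <= r ->
     c * `|u - v| <= `|f u - f v|) ->
  strictly_differentiable f p ->
  nbhs (f p) (f @` [set u | `|u - p| <= r]).
Proof.
move=> r0 c0 fc [L [Ll _ Lf]].
have L0 : L 0 = 0 by have := Ll (-1) 0 0; rewrite scaler0 addr0 scaleN1r addNr.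
have LZ a u : L (a *: u) = a *: L u.
  by have := Ll a u 0; rewrite L0 !addr0.
have LD u v : L (u + v) = L u + L v by rewrite -{1}[u]scale1r Ll scale1r.
pose M := \matrix_(i, j) L (delta_mx 0 i) 0 j.
have LM u : L u = u *m M.
  rewrite {1}[u]row_sum_delta (big_morph L LD L0).
  apply/rowP => j; rewrite summxE mxE; apply: eq_bigr => i _.
  by rewrite LZ !mxE.
have c4 : 0 < c / 4 by rewrite divr_gt0.
have [d0 d00 Hd] := Lf _ c4.
pose d := Num.min d0 r.
have dp : 0 < d by rewrite lt_min d00.
have Lc u : c / 2 * `|u| <= `|u *m M|.
  have [->|u0] := eqVneq u 0; first by rewrite normr0 mulr0.
  have nu : 0 < `|u| by rewrite normr_gt0.
  pose t := d / `|u|.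
  have t0 : 0 < t by rewrite divr_gt0.
  have ht : `|p + t *: u - p| = d.
    by rewrite addrC addKr normrZ gtr0_norm// divfK ?lt0r_neq0.
  have [hd hr] : d <= d0 /\ d <= r by rewrite /d !ge_min !lexx orbT.
  have h1 := fc (p + t *: u) p; rewrite subrr normr0 ht in h1.
  have {}h1 := h1 hr (ltW r0).
  have h2 := Hd (p + t *: u) p; rewrite subrr normr0 ht in h2.
  have {}h2 := h2 hd (ltW d00).
  rewrite [p + _]addrC addrK LM -scalemxAl in h2.
  have h3 := ler_normD (f (t *: u + p) - f p - t *: (u *m M)) (t *: (u *m M)).
  rewrite subrK [X in _ <= _ + X]normrZ (gtr0_norm t0) in h3.
  rewrite [p + _]addrC in h1.
  have h4 : c / 2 * d <= t * `|u *m M|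
    by have := mulr_gt0 c0 dp; lra.
  rewrite -(ler_pM2l t0) mulrCA; apply: le_trans h4.
  by rewrite /t divfK// lt0r_neq0.
have Mu : M \in unitmx.
  rewrite -row_free_unit -kermx_eq0; apply/eqP/row_matrixP => i.
  rewrite row0; apply/eqP; rewrite -normr_le0.
  have c2 : 0 < c / 2 by rewrite divr_gt0.
  by rewrite -(pmulr_rle0 _ c2) (le_trans (Lc _))// -row_mul mulmx_ker row0 normr0.
have Nc u : `|u *m invmx M| <= 2 / c * `|u|.
  have := Lc (u *m invmx M); rewrite mulmxKV// => h.
  rewrite mulrC -ler_pdivrMr ?divr_gt0// invf_div.
  by rewrite mulrC.
pose U : set 'rV[R]_n := [set u | `|u - p| <= d].
have Uc : closed U.
  rewrite (_ : U = closed_ball p d); first exact: closed_ball_closed.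
  by rewrite closed_ballE//; apply/seteqP; split=> u; rewrite /U/closed_ball_/= distrC.
apply/nbhs_ballP; exists (c / 4 * d) => /=; first by rewrite mulr_gt0.
move=> y; rewrite -ball_normE /ball_ /= => yd.
pose P u := u - (f u - y) *m invmx M.
have Plip u v : U u -> U v -> `|P u - P v| <= 1 / 2 * `|u - v|.
  rewrite /U /= => uU vU.
  have -> : P u - P v = - ((f u - f v - L (u - v)) *m invmx M).
    have fuv : f u - f v = (f u - y) - (f v - y) by rewrite opprB addrA subrK.
    rewrite fuv LM mulmxBl mulmxK// mulmxBl /P.
    set a := (f u - y) *m _; set b := (f v - y) *m _.
    by rewrite !opprB [LHS]addrACA [RHS]addrACA (addrC (- a)).
  rewrite normrN; apply: (le_trans (Nc _)).
  have := Hd u v; rewrite !(le_trans uU, le_trans vU) ?ge_min ?lexx//.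
  move=> /(_ isT isT); rewrite -(ler_pM2l (_ : 0 < 2 / c)) ?divr_gt0//.
  move=> /le_trans; apply; rewrite mulrA.
  by rewrite le_eqVlt; apply/orP; left; apply/eqP; congr (_ * _); field; lra.
have PU : {homo P : u / U u}.
  move=> u uU; rewrite /U /=.
  have pU : U p by rewrite /U /= subrr normr0 ltW.
  have h1 := Plip u p uU pU.
  have h2 : `|P p - p| <= 2 / c * (c / 4 * d).
    rewrite /P addrC addKr normrN (le_trans (Nc _))// ler_pM2l ?divr_gt0//.
    exact: ltW.
  have h3 : 2 / c * (c / 4 * d) = d / 2 by field; lra.
  have h4 := ler_normD (P u - P p) (P p - p).
  rewrite subrKA in h4.
  by move: uU; rewrite /U /= => uU; lra.
have [u uU uP] : exists2 u, U u & u = P u.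
  have := @banach_fixed_point R _ U (mkfun_fun PU).
  apply => //.
    have q0 : 0 <= 1 / 2 :> R by lra.
    exists (NngNum q0); split => /=; first lra.
    by move=> [u v] /= [uU vU]; exact: Plip.
  by exists p; rewrite /U /= subrr normr0 ltW.
exists u; first by move: uU; rewrite /U /= => /le_trans; apply; rewrite ge_min lexx orbT.
move: uP; rewrite /P => /eqP; rewrite -subr_eq0 opprB addrC subrK => /eqP h.
by apply/eqP; rewrite -subr_eq0 -[f u - y](mulmxKV Mu) h mul0mx.
Qed.

End StrictDiff.

(** * Midpoint subdivision of the reference cells *)

Section Cells.
Variable R : realType.
Implicit Types (s : cell_type) (p q a : refpt R) (vs : seq (refpt R)).

Lemma refpt_normB_le p q (e : R) :
  (`|p - q| <= e) = [&& `|p.1.1 - q.1.1| <= e, `|p.1.2 - q.1.2| <= e &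
                       `|p.2 - q.2| <= e].
Proof.
by case: p q => [[x y] z] [[x' y'] z']; rewrite prod_normE /= ge_max prod_normE ge_max andbA.
Qed.

(** For a cell with vertices vs, interpolating the vertex functions of the
    parent at vs gives these functions precomposed with A. Hence the element
    map of a child is the element map of the parent composed with A, whatever
    the vertices of the parent are. *)
Definition reparametrizes s vs (A : refpt R -> refpt R) : Prop :=
  forall q j, nth 0 (vertex_weights s (A q)) j =
    \sum_(c <- zip (vertex_weights s q) vs)
       c.1 * nth 0 (vertex_weights s c.2) j.

Definition corner s a := [seq midpoint a b | b <- ref_vertices R s].

(* There are at most eight vertex functions; beyond them both sides are 0. *)
Ltac weight_cases j :=
  do 8? [case: j => [|j] /=; [by rewrite !(big_cons, big_nil) /=; field|]];
  try by rewrite ?nth_nil !(big_cons, big_nil) /= ?nth_nil !mulr0 !addr0.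

(** The vertex functions are affine in each variable, and [midpoint a] scales
    each variable separately, so this needs no assumption on a. *)
Lemma corner_reparametrizes s a : reparametrizes s (corner s a) (midpoint a).
Proof.
case: a => [[a1 a2] a3] [[x y] z] j; case: s; rewrite /corner /midpoint /=.
- by weight_cases j.
- by weight_cases j.
- by weight_cases j.
- by weight_cases j.
- by weight_cases j.
- by weight_cases j.
Qed.

Ltac mem_cases h :=
  first [case/orP: h => [/eqP ->|h]; [|mem_cases h] | move/eqP: h => ->].

Lemma ref_vertices_in s a : a \in ref_vertices R s -> ref_cell s a.
Proof.
case: s; rewrite /= !inE => h; mem_cases h => /=; repeat split; rewrite ?lexx ?ler01//; lra.
Qed.

Lemma midpoint_in_cell s p q :
  ref_cell s p -> ref_cell s q -> ref_cell s (midpoint p q).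
Proof.
case: p q => [[x y] z] [[x' y'] z']; rewrite /midpoint; case: s => /=.
- by move=> [h1 h2 h3] [k1 k2 k3]; split; lra.
- by move=> [h1 h2 h3 h4] [k1 k2 k3 k4]; split; lra.
- by move=> [h1 h2 h3] [k1 k2 k3]; split; lra.
- by move=> [h1 h2 h3 h4] [k1 k2 k3 k4]; split; lra.
- by move=> [h1 h2 h3] [k1 k2 k3]; split; lra.
- by move=> [h1 h2 h3 h4] [k1 k2 k3 k4]; split; lra.
Qed.

(** The point with barycentric coordinates (1 - x - y - z, x, y, z) with
    respect to the four points of v. *)
Definition affine_map (v : seq (refpt R)) q : refpt R :=
  let o : refpt R := nth 0 v 0 in let a : refpt R := nth 0 v 1 in
  let b : refpt R := nth 0 v 2 in let c : refpt R := nth 0 v 3 in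
  let comb (o a b c : R) : R :=
    (1 - q.1.1 - q.1.2 - q.2) * o + q.1.1 * a + q.1.2 * b + q.2 * c in
  (comb o.1.1 a.1.1 b.1.1 c.1.1, comb o.1.2 a.1.2 b.1.2 c.1.2,
   comb o.2 a.2 b.2 c.2).

Lemma tetrahedron_reparametrizes v0 v1 v2 v3 :
  reparametrizes Tetrahedron [:: v0; v1; v2; v3]
    (affine_map [:: v0; v1; v2; v3]).
Proof.
case: v0 v1 v2 v3 => [[x0 y0] z0] [[x1 y1] z1] [[x2 y2] z2] [[x3 y3] z3].
by move=> [[x y] z] j; rewrite /affine_map /=; weight_cases j.
Qed.

(** The middle triangle of a subdivided triangle is the image of the parent
    under a point reflection with factor 1/2; on wedges the height is mapped to
    the lower half for z0 = 0 and to the upper half for z0 = 1. *)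
Definition half_turn (z0 : R) q : refpt R :=
  ((1 - q.1.1) / 2, (1 - q.1.2) / 2, (z0 + q.2) / 2).

Lemma middle_triangle_reparametrizes d :
  reparametrizes Triangle (nth [::] (ref_children R d Triangle) 3)
    (half_turn 0).
Proof. by case=> [[x y] z] j; rewrite /half_turn/midpoint /=; weight_cases j. Qed.

Lemma middle_wedge_reparametrizes d (top : bool) :
  reparametrizes Wedge (nth [::] (ref_children R d Wedge) (6 + top))
    (half_turn top%:R).
Proof.
by case: top; case=> [[x y] z] j; rewrite /half_turn/midpoint /=; weight_cases j.
Qed.

(** A halved copy of the cell only needs the factor 1/2; in a piece of the
    octahedron a barycentric coordinate can be twice a sum of three image
    coordinates, up to a constant, which costs a factor 6. The common bound 1/8
    leaves some room. *)
Definition expansive (A : refpt R -> refpt R) : Prop :=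
  forall p q, 1 / 8 * `|p - q| <= `|A p - A q|.

Lemma expansiveP (A : refpt R -> refpt R) :
  (forall p q e, `|(A p).1.1 - (A q).1.1| <= e ->
    `|(A p).1.2 - (A q).1.2| <= e -> `|(A p).2 - (A q).2| <= e ->
    [/\ `|p.1.1 - q.1.1| <= 8 * e, `|p.1.2 - q.1.2| <= 8 * e & `|p.2 - q.2| <= 8 * e]) ->
  expansive A.
Proof.
move=> H p q; have := lexx `|A p - A q|; rewrite {1}refpt_normB_le.
case/and3P => h1 h2 h3; have [k1 k2 k3] := H _ _ _ h1 h2 h3.
have : `|p - q| <= 8 * `|A p - A q| by rewrite refpt_normB_le k1 k2 k3.
lra.
Qed.

(** What makes a child inherit nondegeneracy from its parent, and be a part of
    it. *)
Definition valid_subcell s vs : Prop := exists A, [/\ reparametrizes s vs A,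
  forall q, ref_cell s q -> ref_cell s (A q),
  size vs = size (ref_vertices R s) & expansive A].

Lemma corner_valid s a : a \in ref_vertices R s -> valid_subcell s (corner s a).
Proof.
move=> sa; exists (midpoint a); split.
- exact: corner_reparametrizes.
- by move=> q; apply: midpoint_in_cell; exact: ref_vertices_in.
- by rewrite size_map.
apply: expansiveP => -[[x y] z] [[x' y'] z'] e /=.
by rewrite !ler_norml => h1 h2 h3; split; lra.
Qed.

Lemma half_turn_valid s vs (z0 : R) :
  reparametrizes s vs (half_turn z0) -> size vs = size (ref_vertices R s) ->
  (forall q, ref_cell s q -> ref_cell s (half_turn z0 q)) -> valid_subcell s vs.
Proof.
move=> svs sz cell_s; exists (half_turn z0); split => //.
apply: expansiveP => -[[x y] z] [[x' y'] z'] e; rewrite /half_turn /=.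
by rewrite !ler_norml => h1 h2 h3; split; lra.
Qed.

Lemma octahedron_cut_valid d vs :
  vs \in drop 4 (ref_children R d Tetrahedron) -> valid_subcell Tetrahedron vs.
Proof.
rewrite /ref_children drop_cat size_map /= drop0 => h.
suff [v0 [v1 [v2 [v3 [-> vcell vexp]]]]] : exists v0 v1 v2 v3,
    [/\ vs = [:: v0; v1; v2; v3], forall q, ref_cell Tetrahedron q ->
     ref_cell Tetrahedron (affine_map [:: v0; v1; v2; v3] q) &
     expansive (affine_map [:: v0; v1; v2; v3])].
  exists (affine_map [:: v0; v1; v2; v3]); split => //.
  exact: tetrahedron_reparametrizes.
move: h; case: d => [[|[|[|//]]] i] /=; rewrite !inE => h;
mem_cases h;
(do 4 eexists; split;
[ reflexivity
| by move=> [[x y] z]; rewrite /affine_map/midpoint /= => -[? ? ? ?]; split; lra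
| by apply: expansiveP => -[[x y] z] [[x' y'] z'] e;
     rewrite /affine_map/midpoint /= !ler_norml => h1 h2 h3; split; lra ]).
Qed.

Lemma ref_children_valid d s vs : vs \in ref_children R d s -> valid_subcell s vs.
Proof.
rewrite mem_cat => /orP[/mapP[a sa ->]|]; first exact: corner_valid.
case: s => //=.
- rewrite inE => /eqP ->.
  apply: half_turn_valid (middle_triangle_reparametrizes d) _ _ => // -[[x y] z].
  by rewrite /half_turn /= => -[? ? ? ?]; split; lra.
- move=> h; apply: (@octahedron_cut_valid d).
  by rewrite /ref_children drop_cat size_map /= drop0.
- rewrite !inE => /orP[] /eqP ->.
    apply: half_turn_valid (middle_wedge_reparametrizes d false) _ _ => //.
    by move=> [[x y] z]; rewrite /half_turn /= => -[? ? ? ?]; split; lra.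
  apply: half_turn_valid (middle_wedge_reparametrizes d true) _ _ => //.
  by move=> [[x y] z]; rewrite /half_turn /= => -[? ? ? ?]; split; lra.
Qed.

End Cells.

Section Cover.
Variable R : realType.
Implicit Types (s : cell_type) (p q a : refpt R) (vs : seq (refpt R)).

Definition in_subcell d s p : Prop := exists vs A q,
  [/\ vs \in ref_children R d s, reparametrizes s vs A, ref_cell s q & p = A q].

(** The corner child at a consists of the points whose dilation by 2 from a
    stays in the cell. *)
Lemma corner_in_subcell d s a p : a \in ref_vertices R s ->
  ref_cell s (2 * p.1.1 - a.1.1, 2 * p.1.2 - a.1.2, 2 * p.2 - a.2) ->
  in_subcell d s p.
Proof.
move=> sa sq; exists (corner s a), (midpoint a).
exists (2 * p.1.1 - a.1.1, 2 * p.1.2 - a.1.2, 2 * p.2 - a.2); split => //.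
- by rewrite mem_cat map_f.
- exact: corner_reparametrizes.
- by case: p a {sa sq} => [[x y] z] [[u v] w]; rewrite /midpoint /=;
    repeat congr pair; field.
Qed.

Lemma half_interval (t : R) : 0 <= t <= 1 ->
  exists2 a, a = 0 \/ a = 1 & 0 <= 2 * t - a <= 1.
Proof.
move=> t01; have [h|h] := lerP t (1 / 2).
  by exists 0; [left | lra].
by exists 1; [right | lra].
Qed.

Ltac mem_list :=
  first [exact: mem_head | rewrite in_cons; apply/orP; right; mem_list].

Ltac use_corner a := apply: (@corner_in_subcell _ _ a) => /=;
  [by mem_list | by split; lra].

(** The first four children of a tetrahedron are its corners, the other four
    cut the octahedron. *)
Lemma octahedron_in_subcell d i q p : (i < 4)%N -> ref_cell Tetrahedron q ->
  p = affine_map (nth [::] (ref_children R d Tetrahedron) (4 + i)%N) q ->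
  in_subcell d Tetrahedron p.
Proof.
move=> i4 qc ->; exists (nth [::] (ref_children R d Tetrahedron) (4 + i)%N).
exists (affine_map (nth [::] (ref_children R d Tetrahedron) (4 + i)%N)), q.
split => //.
  apply: mem_nth; have -> : size (ref_children R d Tetrahedron) = (4 + 4)%N.
    by case: d => [[|[|[|]]]].
  by rewrite ltn_add2l.
move: i i4; case: d => [[|[|[|//]]] ?] [|[|[|[|//]]]] _ ;
 exact: tetrahedron_reparametrizes.
Qed.

(** In the tetrahedron, the octahedron is cut along the diagonal that joins the
    midpoint of the edge from the origin to the vertex a with the midpoint of
    the edge between b and c. With u, v, w the coordinates along a, b, c, the
    piece containing the point depends on whether u + v and u + w exceed 1/2,
    and the barycentric coordinates in that piece are found by solving a linear
    system; a ranges over the three coordinates according to d. *)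
Lemma ref_children_cover d s p : ref_cell s p -> in_subcell d s p.
Proof.
case: s; case: p => [[x y] z] /=.
- move=> [h1 h2 h3]; have [hx|hx] := lerP x (1 / 2).
    by use_corner ((0, 0, 0) : refpt R).
  by use_corner ((1, 0, 0) : refpt R).
- move=> [h1 h2 h3 h4]; have [hx|hx] := lerP x (1 / 2); last first.
    by use_corner ((1, 0, 0) : refpt R).
  have [hy|hy] := lerP y (1 / 2); last first.
    by use_corner ((0, 1, 0) : refpt R).
  have [hxy|hxy] := lerP (x + y) (1 / 2).
    by use_corner ((0, 0, 0) : refpt R).
  exists (nth [::] (ref_children R d Triangle) 3), (half_turn 0).
  exists (1 - 2 * x, 1 - 2 * y, z); split.
  - exact: mem_nth.
  - exact: middle_triangle_reparametrizes.
  - by split; lra.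
  - by rewrite /half_turn; repeat congr pair => /=; lra.
- move=> [/half_interval[a a0 ha] /half_interval[b b0 hb] h3].
  apply: (@corner_in_subcell _ _ (a, b, 0)); last by split=> //=; lra.
  by case: a0 => ->; case: b0 => ->; mem_list.
- move=> [h1 h2 h3 h4]; have [hx|hx] := lerP x (1 / 2); last first.
    by use_corner ((1, 0, 0) : refpt R).
  have [hy|hy] := lerP y (1 / 2); last first.
    by use_corner ((0, 1, 0) : refpt R).
  have [hz|hz] := lerP z (1 / 2); last first.
    by use_corner ((0, 0, 1) : refpt R).
  have [hs|hs] := lerP (x + y + z) (1 / 2).
    by use_corner ((0, 0, 0) : refpt R).
  case: d => [[|[|[|//]]] i].
  - have [huw|huw] := lerP (x + z) (1 / 2);
      have [huv|huv] := lerP (x + y) (1 / 2);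
    [ apply: (@octahedron_in_subcell _ 0
          (2 * x + 2 * y + 2 * z - 1, 1 - 2 * x - 2 * z,
           1 - 2 * x - 2 * y))
    | apply: (@octahedron_in_subcell _ 3
          (2 * z, 2 * x + 2 * y - 1,
           1 - 2 * x - 2 * z))
    | apply: (@octahedron_in_subcell _ 1
          (2 * y, 1 - 2 * x - 2 * y,
           2 * x + 2 * z - 1))
    | apply: (@octahedron_in_subcell _ 2
          (1 - 2 * x, 2 * x + 2 * z - 1,
           2 * x + 2 * y - 1))] => //;
    by [rewrite /affine_map /=; repeat congr pair; field | split; lra].
  - have [huw|huw] := lerP (y + z) (1 / 2);
      have [huv|huv] := lerP (y + x) (1 / 2);
    [ apply: (@octahedron_in_subcell _ 0
          (2 * x + 2 * y + 2 * z - 1, 1 - 2 * y - 2 * z,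
           1 - 2 * y - 2 * x))
    | apply: (@octahedron_in_subcell _ 3
          (2 * z, 2 * y + 2 * x - 1,
           1 - 2 * y - 2 * z))
    | apply: (@octahedron_in_subcell _ 1
          (2 * x, 1 - 2 * y - 2 * x,
           2 * y + 2 * z - 1))
    | apply: (@octahedron_in_subcell _ 2
          (1 - 2 * y, 2 * y + 2 * z - 1,
           2 * y + 2 * x - 1))] => //;
    by [rewrite /affine_map /=; repeat congr pair; field | split; lra].
  - have [huw|huw] := lerP (z + y) (1 / 2);
      have [huv|huv] := lerP (z + x) (1 / 2);
    [ apply: (@octahedron_in_subcell _ 0
          (2 * x + 2 * y + 2 * z - 1, 1 - 2 * z - 2 * y,
           1 - 2 * z - 2 * x))
    | apply: (@octahedron_in_subcell _ 3
          (2 * y, 2 * z + 2 * x - 1,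
           1 - 2 * z - 2 * y))
    | apply: (@octahedron_in_subcell _ 1
          (2 * x, 1 - 2 * z - 2 * x,
           2 * z + 2 * y - 1))
    | apply: (@octahedron_in_subcell _ 2
          (1 - 2 * z, 2 * z + 2 * y - 1,
           2 * z + 2 * x - 1))] => //;
    by [rewrite /affine_map /=; repeat congr pair; field | split; lra].
- move=> [/half_interval[a a0 ha] /half_interval[b b0 hb] /half_interval[c c0 hc]].
  apply: (@corner_in_subcell _ _ (a, b, c)) => //.
  by case: a0 => ->; case: b0 => ->; case: c0 => ->; mem_list.
- move=> [h1 h2 h3 /half_interval[c c0 hc]].
  have wedge_corner (a b : R) :
      [\/ a = 0 /\ b = 0, a = 1 /\ b = 0 | a = 0 /\ b = 1] ->
      0 <= 2 * x - a -> 0 <= 2 * y - b -> 2 * x - a + (2 * y - b) <= 1 ->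
      in_subcell d Wedge (x, y, z).
    move=> ab ha hb hab; apply: (@corner_in_subcell _ _ (a, b, c)) => //.
    by case: ab => -[-> ->]; case: c0 => ->; mem_list.
  have [hx|hx] := lerP x (1 / 2); last first.
    by apply: (wedge_corner 1 0); [exact: Or32 | lra..].
  have [hy|hy] := lerP y (1 / 2); last first.
    by apply: (wedge_corner 0 1); [exact: Or33 | lra..].
  have [hxy|hxy] := lerP (x + y) (1 / 2).
    by apply: (wedge_corner 0 0); [exact: Or31 | lra..].
  have [top tc] : exists top : bool, c = top%:R.
    by case: c0 => ->; [exists false | exists true].
  exists (nth [::] (ref_children R d Wedge) (6 + top)), (half_turn c).
  exists (1 - 2 * x, 1 - 2 * y, 2 * z - c); split.
  - by apply: mem_nth; case: (top).
  - by rewrite tc; exact: middle_wedge_reparametrizes.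
  - by split => //; lra.
  - by rewrite /half_turn; repeat congr pair => /=; lra.
Qed.

End Cover.

(** * Element maps on row vectors *)

Section Weights.
Variable R : realType.
Implicit Types (s : cell_type) (p q : refpt R).

Lemma size_vertex_weights s p : size (vertex_weights s p) = size (ref_vertices R s).
Proof. by case: s; case: p => [[x y] z]. Qed.

(** The condition on the coordinates beyond the dimension of the cell, which
    [emb] satisfies by construction. *)
Definition flat s p : Prop :=
  ((cell_dim s <= 1)%N -> p.1.2 = 0) /\ ((cell_dim s <= 2)%N -> p.2 = 0).

(** This describes every cell type by weak inequalities between polynomials, so
    that closedness can be proved for all of them at once. For products of
    intervals, the weights sum up to the linear constraints: x (1 - y) + x y
    is x. *)
Lemma ref_cell_weights s p :
  ref_cell s p <-> flat s p /\ forall j, 0 <= (vertex_weights s p)`_j.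
Proof.
case: p => [[x y] z]; split.
- have H (t : R) : 0 <= t <= 1 -> 0 <= t /\ 0 <= 1 - t by case/andP; rewrite subr_ge0.
  case: s => /=.
  + move=> [/H[? ?] ? ?]; split=> // j; move: j; do 2 (case; first by []); move=> j.
    by rewrite /= nth_nil.
  + move=> [? ? ? ?]; split=> // j.
    by move: j; do 3 (case; first by rewrite /=; lra); move=> j; rewrite /= nth_nil.
  + move=> [/H[? ?] /H[? ?] ?]; split=> // j.
    by move: j; do 4 (case; first by rewrite /= mulr_ge0); move=> j; rewrite /= nth_nil.
  + move=> [? ? ? ?]; split=> // j.
    by move: j; do 4 (case; first by rewrite /=; lra); move=> j; rewrite /= nth_nil.
  + move=> [/H[? ?] /H[? ?] /H[? ?]]; split=> // j.
    by move: j; do 8 (case; first by rewrite /= !mulr_ge0); move=> j; rewrite /= nth_nil.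
  + move=> [? ? ? /H[? ?]]; split=> // j.
    by move: j; do 6 (case; first by rewrite /= mulr_ge0//; lra); move=> j; rewrite /= nth_nil.
- move=> [[h1 h2] h].
  move: (h 0%N) (h 1%N) (h 2%N) (h 3%N) (h 4%N) (h 5%N) (h 6%N) (h 7%N) => {h}.
  case: s h1 h2 => /= h1 h2 *;
  rewrite ?(h1 isT) ?(h2 isT); split => //; lra.
Qed.

End Weights.

Section Embedding.
Variables (R : realType) (n : nat).
Implicit Types (s : cell_type) (v u : 'rV[R]_n) (p q : refpt R).

(** [emb] identifies row vectors of dimension n = cell_dim s with the flat
    points of R^3, so that the element map becomes a map between spaces of the
    same dimension. *)
Definition coord_or0 i v : R := oapp (fun j => v 0 j) 0 (insub i : option 'I_n).

Definition emb v : refpt R := (coord_or0 0 v, coord_or0 1 v, coord_or0 2 v).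

Lemma coord_or0_val (j : 'I_n) v : coord_or0 j v = v 0 j.
Proof. by rewrite /coord_or0 valK. Qed.

Lemma coord_or0_out i v : (n <= i)%N -> coord_or0 i v = 0.
Proof. by move=> ni; rewrite /coord_or0 insubN// -leqNgt. Qed.

Lemma coord_or0B i u v : coord_or0 i (u - v) = coord_or0 i u - coord_or0 i v.
Proof. by rewrite /coord_or0; case: insubP => [j _ _|_] /=; rewrite ?mxE ?subrr. Qed.

Lemma norm_le_emb u v : (n <= 3)%N -> `|u - v| <= `|emb u - emb v|.
Proof.
move=> n3; rewrite [leLHS]/Num.norm /= mx_normrE; apply/bigmax_leP; split=> //.
move=> [i j] _ /=; rewrite ord1 -coord_or0_val coord_or0B.
have := lexx `|emb u - emb v|; rewrite {1}refpt_normB_le /= => /and3P[h0 h1 h2].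
have : (j < 3)%N by rewrite (leq_trans (ltn_ord j)).
by case: (nat_of_ord j) => [|[|[|]]].
Qed.

Lemma flat_emb s v : n = cell_dim s -> flat s (emb v).
Proof. by move=> ns; split => h; rewrite /= coord_or0_out// ns. Qed.

Lemma emb_onto s p : n = cell_dim s -> ref_cell s p -> exists v, emb v = p.
Proof.
move=> ns /ref_cell_weights[[h1 h2] _].
exists (\row_j nth 0 [:: p.1.1; p.1.2; p.2] j).
have H i : coord_or0 i (\row_j nth 0 [:: p.1.1; p.1.2; p.2] j) =
    if (i < n)%N then nth 0 [:: p.1.1; p.1.2; p.2] i else 0.
  rewrite /coord_or0; case: insubP => [j -> <-|/negbTE ->] //=; by rewrite mxE.
rewrite /emb !H /= ns; case: p h1 h2 {H} => [[x y] z]; case: s {ns} => /= h1 h2;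
by rewrite ?(h1 isT) ?(h2 isT).
Qed.

Lemma sdiff_coord_or0 i v : strictly_differentiable (coord_or0 i : 'rV[R]_n -> R^o) v.
Proof.
rewrite /coord_or0; case: insubP => [j _ _|_] /=; first exact: sdiff_coord.
exact: sdiff_cst.
Qed.

Lemma sdiffM (f g : 'rV[R]_n -> R^o) v : strictly_differentiable f v ->
  strictly_differentiable g v -> strictly_differentiable (fun u => f u * g u : R^o) v.
Proof. exact: sdiffZ. Qed.

Lemma sdiffB (f g : 'rV[R]_n -> R^o) v : strictly_differentiable f v ->
  strictly_differentiable g v -> strictly_differentiable (fun u => f u - g u : R^o) v.
Proof.
move=> sf sg; apply: sdiffD => //.
under [X in strictly_differentiable X]funext => u do rewrite -mulN1r.
by apply: sdiffM => //; exact: sdiff_cst.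
Qed.

Lemma sdiff_weights s j v :
  strictly_differentiable (fun u => (vertex_weights s (emb u))`_j : R^o) v.
Proof.
have c := sdiff_coord_or0; have k := @sdiff_cst R n R^o.
case: s => /=; move: j;
do 8? [case=> [|] /=; first by
  repeat first [exact: c | exact: k | apply: sdiffM | apply: sdiffB]];
move=> j; try (by
  under [X in strictly_differentiable X]funext => u do rewrite nth_nil);
by repeat first [exact: c | exact: k | apply: sdiffM | apply: sdiffB].
Qed.

Lemma sdiff_continuous (V : normedModType R) (f : 'rV[R]_n -> V) v :
  strictly_differentiable f v -> {for v, continuous f}.
Proof.
move=> /sdiff_lipschitz[K K0 [d d0 H]].
have ff := nbhs_filter v; apply/cvgrPdist_le => /= e e0.
have r0 : 0 < Num.min d (e / K) by rewrite lt_min d0 divr_gt0.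
apply: filterS (nbhsx_ballx v _ r0) => u; rewrite -ball_normE /ball_ /= lt_min => /andP[u1 u2].
have uK : K * `|v - u| <= e by rewrite mulrC -ler_pdivlMr// ltW.
apply: le_trans uK; apply: H; first by rewrite subrr normr0 ltW.
by rewrite distrC ltW.
Qed.

End Embedding.

Lemma ref_cell_norm (R : realType) s (p : refpt R) : ref_cell s p -> `|p - 0| <= 1.
Proof.
rewrite refpt_normB_le /= !subr0 !ler_norml; case: p => [[x y] z]; case: s => /=.
- by move=> [h1 h2 h3]; apply/and3P; split; lra.
- by move=> [h1 h2 h3 h4]; apply/and3P; split; lra.
- by move=> [h1 h2 h3]; apply/and3P; split; lra.
- by move=> [h1 h2 h3 h4]; apply/and3P; split; lra.
- by move=> [h1 h2 h3]; apply/and3P; split; lra.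
- by move=> [h1 h2 h3 h4]; apply/and3P; split; lra.
Qed.

(** Moving from a point p of the cell by a fraction t towards the inner point
    (1/4, 1/4, 1/4) leaves room for a cube of size t / 12 in the cell: the
    tightest constraint is x + y + z <= 1, where the gain t / 4 is shared by
    three coordinates. *)
Lemma ref_cell_inner (R : realType) s (p q : refpt R) (t : R) :
  0 < t <= 1 -> ref_cell s p -> flat s q ->
  `|q.1.1 - (p.1.1 + t * (1 / 4 - p.1.1))| <= t / 12 ->
  ((1 < cell_dim s)%N -> `|q.1.2 - (p.1.2 + t * (1 / 4 - p.1.2))| <= t / 12) ->
  ((2 < cell_dim s)%N -> `|q.2 - (p.2 + t * (1 / 4 - p.2))| <= t / 12) ->
  ref_cell s q.
Proof.
move=> /andP[t0 t1]; case: p q => [[x y] z] [[x' y'] z'].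
have tx (a : R) : 0 <= a -> 0 <= (1 - t) * a.
  by move=> a0; rewrite mulr_ge0// subr_ge0.
have tx1 (a : R) : a <= 1 -> 0 <= (1 - t) * (1 - a).
  by move=> a1; rewrite mulr_ge0// subr_ge0.
rewrite /flat !ler_norml; case: s => /=.
- move=> [/andP[/tx h1 /tx1 h2] _ _] [fy fz] hx _ _.
  by split; [lra|exact: fy|exact: fz].
- move=> [/tx h1 /tx h2 /tx1 h3 _] [_ fz] hx /(_ isT) hy _.
  by split; [lra|lra|lra|exact: fz].
- move=> [/andP[/tx h1 /tx1 h3] /andP[/tx h2 /tx1 h4] _] [_ fz] hx /(_ isT) hy _.
  by split; [lra|lra|exact: fz].
- move=> [/tx h1 /tx h2 /tx h3 /tx1 h4] _ hx /(_ isT) hy /(_ isT) hz.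
  by split; lra.
- move=> [/andP[/tx h1 /tx1 h4] /andP[/tx h2 /tx1 h5] /andP[/tx h3 /tx1 h6]].
  by move=> _ hx /(_ isT) hy /(_ isT) hz; split; lra.
- move=> [/tx h1 /tx h2 /tx1 h4 /andP[/tx h3 /tx1 h5]] _ hx /(_ isT) hy /(_ isT) hz.
  by split; lra.
Qed.

Lemma zip_mapr (A B C : Type) (f : B -> C) (s : seq A) (t : seq B) :
  zip s (map f t) = [seq (c.1, f c.2) | c <- zip s t].
Proof. by elim: s t => [|a s IH] [|b t] //=; rewrite IH. Qed.

Section Elements.
Variables (R : realType) (n : nat).
Implicit Types (T C : element R n) (p q : refpt R) (vs : seq (refpt R)) (d : 'I_3).

Lemma geom_mapE T p : size (el_vertices T) = size (ref_vertices R (el_type T)) ->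
  geom_map T p = \sum_(j < size (ref_vertices R (el_type T)))
    (vertex_weights (el_type T) p)`_j *: (el_vertices T)`_j.
Proof.
move=> sz; rewrite /geom_map (big_nth (0, 0)) size_zip size_vertex_weights sz minnn.
rewrite big_mkord; apply: eq_bigr => j _.
by rewrite nth_zip// size_vertex_weights sz.
Qed.

Lemma geom_map_reparam T vs A q :
  size (el_vertices T) = size (ref_vertices R (el_type T)) ->
  reparametrizes (el_type T) vs A ->
  geom_map (Element (el_type T) (map (geom_map T) vs)) q = geom_map T (A q).
Proof.
move=> sz rA; rewrite [RHS]geom_mapE//.
under eq_bigr => j _ do rewrite rA scaler_suml.
rewrite exchange_big /= {1}/geom_map /= zip_mapr.
rewrite big_map; apply: eq_bigr => c _ /=.
rewrite geom_mapE// scaler_sumr; apply: eq_bigr => j _.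
by rewrite scalerA.
Qed.

Lemma children_nondegenerate d T C : Defs.nondegenerate T -> children d T C ->
  Defs.nondegenerate C /\ el_set C `<=` el_set T.
Proof.
move=> [dimT sz [c c0 cT]] [vs vsT ->].
have [A [rA cellA szA expA]] := ref_children_valid vsT.
have gm q := geom_map_reparam q sz rA.
split; last by move=> _ [q qc <-]; rewrite gm; exists (A q) => //; exact: cellA.
split => //=; first by rewrite size_map szA.
exists (c / 8); first by rewrite divr_gt0.
move=> p q pc qc; rewrite !gm; apply: le_trans (cT _ _ (cellA _ pc) (cellA _ qc)).
by rewrite -mulrA ler_pM2l// mulrC; have := expA p q; lra.
Qed.

Lemma children_cover d T y : Defs.nondegenerate T -> el_set T y ->
  exists2 C, children d T C & el_set C y.
Proof.
move=> [_ sz _] [p pc <-].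
have [vs [A [q [vsT rA qc ->]]]] := ref_children_cover d pc.
exists (Element (el_type T) (map (geom_map T) vs)); first by exists vs.
by exists q => //; exact: geom_map_reparam.
Qed.

Lemma finite_children d T : finite_set (children d T).
Proof.
rewrite (_ : children d T = (fun vs => Element (el_type T) (map (geom_map T) vs))
  @` [set` ref_children R d (el_type T)]).
  exact/finite_image/finite_seq.
by apply/seteqP; split=> C [vs h e]; exists vs.
Qed.

Lemma sdiff_geom_map T v : size (el_vertices T) = size (ref_vertices R (el_type T)) ->
  strictly_differentiable (fun u : 'rV[R]_n => geom_map T (emb u)) v.
Proof.
move=> sz; under [X in strictly_differentiable X]funext => u do rewrite geom_mapE//.
elim: (size (ref_vertices _ _)) => [|m IH].
  by under [X in strictly_differentiable X]funext => u do rewrite big_ord0; exact: sdiff_cst.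
under [X in strictly_differentiable X]funext => u do rewrite big_ord_recr.
by apply: sdiffD => //=; apply: sdiffZ; [exact: sdiff_weights | exact: sdiff_cst].
Qed.

Lemma el_set_emb T : Defs.nondegenerate T ->
  el_set T = (fun u : 'rV[R]_n => geom_map T (emb u)) @`
    [set u | ref_cell (el_type T) (emb u)].
Proof.
move=> [dimT _ _]; apply/seteqP; split => [_ [p pc <-]|_ [u uc <-]].
  by have [v vp] := emb_onto (esym dimT) pc; exists v; rewrite ?/mkset vp.
by exists (emb u).
Qed.

Lemma closed_el_set T : Defs.nondegenerate T -> closed (el_set T).
Proof.
move=> ndT; rewrite el_set_emb//; have [dimT sz _] := ndT.
apply: compact_closed; first exact: norm_hausdorff.
apply: continuous_compact.
  by apply: continuous_subspaceT => v; apply: sdiff_continuous; exact: sdiff_geom_map.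
apply: bounded_closed_compact.
- exists 1; split => // e e1 u uc; apply: le_trans (ltW e1).
  have n3 : (n <= 3)%N by rewrite -dimT; case: (el_type T).
  rewrite -[u]subr0; apply: le_trans (norm_le_emb _ _ n3) _.
  suff -> : emb (0 : 'rV[R]_n) = 0 by exact: ref_cell_norm uc.
  by rewrite -(subrr (0 : 'rV[R]_n)) /emb !coord_or0B !subrr.
- rewrite (_ : [set u | _] = \bigcap_j
      [set u | 0 <= (vertex_weights (el_type T) (emb u))`_j]); last first.
    apply/seteqP; split => [u uc j _|u h].
      by have [_] := (ref_cell_weights _ _).1 uc; apply.
    apply: (ref_cell_weights _ _).2; split; first exact/flat_emb/esym.
    by move=> j; exact: h.
  apply: closed_bigI => j _.
  apply: (@closed_comp _ _ _ [set x : R^o| 0 <= x]); last exact: closed_ge.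
  by move=> v _; apply: sdiff_continuous; exact: sdiff_weights.
Qed.

(** A point of the element is the image of some v; the point v' slightly closer
    to the inner point of the cell has a neighborhood in the cell, on which the
    element map has the lower Lipschitz bound of a nondegenerate element, so the
    image of v' is interior. *)
Lemma el_set_interior T : Defs.nondegenerate T ->
  el_set T `<=` closure (interior (el_set T)).
Proof.
move=> ndT y; rewrite {1}el_set_emb// => -[v vc <-] B nB.
have [dimT sz [c c0 cT]] := ndT.
set f := fun u : 'rV[R]_n => geom_map T (emb u).
have n3 : (n <= 3)%N by rewrite -dimT; case: (el_type T).
have fv : {for v, continuous f} by apply: sdiff_continuous; exact: sdiff_geom_map.
have [e /= e0 eB] := (nbhs_ballP _ _).1 (fv _ nB).
pose m : 'rV[R]_n := const_mx (1 / 4).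
(* The move t * |m - v| has to stay below e, the radius given by continuity. *)
pose t := Num.min 1 (e / 2 / (1 + `|m - v|)).
have mv : 0 < 1 + `|m - v| by rewrite ltr_pwDl.
have t0 : 0 < t by rewrite lt_min ltr01 !divr_gt0.
have t1 : t <= 1 by rewrite ge_min lexx.
pose v' := v + t *: (m - v).
have inner_cell u : `|u - v'| <= t / 12 -> ref_cell (el_type T) (emb u).
  move=> uv'.
  have near_v' i : (i < n)%N -> `|coord_or0 i u -
      (coord_or0 i v + t * (1 / 4 - coord_or0 i v))| <= t / 12.
    move=> lt_in; apply: le_trans uv'.
    have := norm_row_coord (u - v') (Ordinal lt_in).
    by rewrite !mxE -!coord_or0_val.
  have t01 : 0 < t <= 1 by rewrite t0.
  apply: (ref_cell_inner t01 vc).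
  - exact/flat_emb/esym.
  - by apply: near_v'; rewrite -dimT; case: (el_type T).
  - by rewrite dimT; exact: near_v'.
  - by rewrite dimT; exact: near_v'.
have fv' : nbhs (f v') (el_set T).
  have t12 : 0 < t / 12 by rewrite divr_gt0.
  apply: filterS (@strict_open_map _ _ f v' (t / 12) c t12 c0 _ _).
  - by move=> _ [u uc <-]; exists (emb u) => //; exact: inner_cell.
  - move=> a b ha hb; apply: le_trans (cT _ _ (inner_cell _ ha) (inner_cell _ hb)).
    by rewrite ler_pM2l//; exact: norm_le_emb.
  - exact: sdiff_geom_map.
exists (f v'); split => //; apply: eB; rewrite -ball_normE /ball_ /=.
rewrite opprD addrA subrr add0r normrN normrZ gtr0_norm//.
have : t * (1 + `|m - v|) <= e / 2 by rewrite -ler_pdivlMr// ge_min lexx orbT.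
rewrite mulrDr; lra.
Qed.

End Elements.

(** * Levels of the grid *)

Section Grid.
Variables (R : realType) (n : nat) (Omega : set 'rV[R]_n) (J : nat).
Variables (Theta : nat -> set 'rV[R]_n) (Tri : nat -> set (element R n)).
Hypothesis grid : refined_grid Omega J Theta Tri.

Lemma Tri_elements k : (k <= J)%N -> finite_set (Tri k) /\
  forall T, Tri k T -> Defs.nondegenerate T /\ el_set T `<=` Omega.
Proof.
elim: k => [_|k IH kJ].
  have [fin nd cov _] := rg_regular grid; split => // T T0; split; first exact: nd.
  by move=> y Ty; rewrite -cov; exists T.
have [fin ndsub] := IH (ltnW kJ); have [d ->] := rg_refine grid kJ; split.
  rewrite finite_setU; split; first by apply: sub_finite_set fin => T [].
  apply: bigcup_finite; first by apply: sub_finite_set fin => T [].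
  by move=> T _; exact: finite_children.
move=> T [[/ndsub//]|[T' [/ndsub[nd' sub'] _] TT']].
have [nd sub] := children_nondegenerate nd' TT'; split => //.
exact: subset_trans sub sub'.
Qed.

Lemma Theta_covered k y : (k <= J)%N -> Theta k y ->
  exists T, [/\ Tri k T, el_set T `<=` Theta k & el_set T y].
Proof.
case: k => [_|k kJ].
  rewrite (rg_Theta0 grid); have [_ _ cov _] := rg_regular grid.
  rewrite -cov => -[T T0 Ty]; exists T; split => //.
  by move=> z Tz; exists T.
have [S STri cS] := rg_Theta_union grid kJ; rewrite {1}cS => -[T TS Ty].
have [fin nd] := Tri_elements (ltnW kJ).
have [ndT _] := nd _ (STri _ TS).
have [d Trik] := rg_refine grid kJ.
have [C TC Cy] := children_cover (d T) ndT Ty.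
have [_ CT] := children_nondegenerate ndT TC.
have subT : el_set T `<=` Theta k.+1 by rewrite cS => z Tz; exists T.
exists C; split => //; last exact: subset_trans CT subT.
by rewrite Trik; right; exists T => //; split => //; exact: STri.
Qed.

Lemma Theta_mono l m : (l <= m)%N -> (m <= J)%N -> Theta m `<=` Theta l.
Proof.
elim: m => [|m IH]; first by rewrite leqn0 => /eqP -> _.
rewrite leq_eqVlt => /orP[/eqP -> _ //|lm mJ].
exact: subset_trans (rg_Theta_sub grid mJ) (IH lm (ltnW mJ)).
Qed.

(** Later refinement regions lie in Theta_{l+1}, so they cannot contain T. *)
Lemma unrefined_element k l T : (l < k)%N -> (k <= J)%N ->
  Tri l T -> ~ el_set T `<=` Theta l.+1 -> Tri k T.
Proof.
move=> + + Tl nT; elim: k => // k IH lk kJ.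
have [d ->] := rg_refine grid kJ; left; split.
  by move: lk; rewrite ltnS leq_eqVlt => /orP[/eqP <- //|lk]; apply: IH => //; exact: ltnW.
by move=> Tk; apply: nT; apply: subset_trans Tk (Theta_mono lk kJ).
Qed.

(** For l < k the set Omega_k^l is a closure, but the elements of T_l on Theta_l
    and not on Theta_{l+1} are finitely many and closed, so they also cover the
    limit points. Such an element has points outside the closed set Theta_{l+1},
    hence also interior points outside it. *)
Lemma Tri_lev_covers k l y : (l <= k)%N -> (k <= J)%N -> Omega_lev Theta k l y ->
  exists2 T, Tri_lev Theta Tri k l T & el_set T y.
Proof.
move=> lk kJ; have [lt_lk|ge_lk] := ltnP l k; last first.
  have -> : l = k by apply/eqP; rewrite eqn_leq lk.
  rewrite /Tri_lev /Omega_lev ltnn => /(Theta_covered kJ)[T [Tk Tsub Ty]].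
  exists T => //; split => //.
  have [_ /(_ _ Tk)[ndT _]] := Tri_elements kJ.
  have [z [zT _]] := el_set_interior ndT Ty filterT.
  exists z; split; first exact: interior_subset.
  exact: interiorS zT.
have lJ := leq_trans lk kJ.
rewrite /Tri_lev /Omega_lev lt_lk => yO.
have [fin nd] := Tri_elements lJ.
pose S := [set T | [/\ Tri l T, el_set T `<=` Theta l & ~ el_set T `<=` Theta l.+1]].
have Scl : closed (covered S).
  have el0 : finite_set [set el_set T | T in S].
    by apply: finite_image; apply: sub_finite_set fin => T [].
  rewrite (_ : covered S = \bigcup_(A in [set el_set T | T in S]) A).
    apply: closed_bigcup => // _ [T [Tl _ _] <-].
    by apply: closed_el_set; case: (nd _ Tl).
  by rewrite bigcup_image.
have subS : Theta l `\` Theta l.+1 `<=` covered S.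
  move=> z [/(Theta_covered lJ)[T [Tl Tsub Tz]] nz]; exists T => //; split=> //.
  by move=> /(_ z Tz).
have [T [Tl Tsub nT] Ty] : covered S y.
  by rewrite ((closure_id _).1 Scl); exact: closure_subset yO.
exists T => //; split; first exact: unrefined_element nT.
have [ndT _] := nd _ Tl.
have [p Tp nTp] : exists2 p, el_set T p & ~ Theta l.+1 p.
  apply: contrapT => H; apply: nT => p Tp; apply: contrapT => np; apply: H.
  by exists p.
have oTh : open (~` Theta l.+1).
  by apply/closed_openC/(rg_Theta_closed grid)/(leq_trans lt_lk kJ).
have [z [zT nz]] := el_set_interior ndT Tp (open_nbhs_nbhs (conj oTh nTp)).
exists z; split; first exact: interior_subset.
have nz' := open_nbhs_nbhs (conj oTh nz).
apply: filterS (filterI zT nz') => u [Tu nu].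
by apply: subset_closure; split => //; exact: Tsub.
Qed.

Lemma Omega_lev_exists k y : (k <= J)%N -> Omega y ->
  exists2 l, (l <= k)%N & Omega_lev Theta k l y.
Proof.
move=> kJ Oy.
have H m : (m <= k)%N ->
    Theta m y \/ exists2 l, (l < m)%N & (Theta l `\` Theta l.+1) y.
  elim: m => [_|m IH mk]; first by left; rewrite (rg_Theta0 grid).
  case: (IH (ltnW mk)) => [Tm|[l lm Tl]]; last by right; exists l => //; exact: ltnW.
  by have [Tm1|nTm1] := pselect (Theta m.+1 y); [left | right; exists m].
case: (H k (leqnn k)) => [Tk|[l lk Tl]].
  by exists k => //; rewrite /Omega_lev ltnn.
by exists l; [exact: ltnW | rewrite /Omega_lev lk; exact: subset_closure].
Qed.

Lemma level_ofP k y : (k <= J)%N -> Omega y ->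
  (level_of Theta k y <= k)%N /\ Omega_lev Theta k (level_of Theta k y) y.
Proof.
move=> kJ /(Omega_lev_exists kJ)[l lk yl].
have [g gl yg] : exists2 g, (g <= l)%N & E_lev Theta k g y.
  have : Omega_upto Theta k l y by exists l => //=.
  elim: {lk yl} l => [|l IH] yl; first by exists 0%N.
  have [/IH[g gl yg]|ny] := pselect (Omega_upto Theta k l y).
    by exists g => //; exact: leqW.
  by exists l.+1.
rewrite /level_of; case: xgetP => [{g gl yg} g _ /= [gk yg]|].
  split => //; case: g gk yg => [|g] gk /=.
    by case=> m /=; rewrite leqn0 => /eqP ->.
  move=> [[m /= mg ym] ny]; move: mg; rewrite leq_eqVlt => /orP[/eqP <- //|mg].
  by case: ny; exists m.
by move=> /(_ g); case; split => //; exact: leq_trans lk.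
Qed.

Lemma X_all_sub r (F : lagrange_family R r) k : (k <= J)%N ->
  X_all F Theta Tri k `<=` Omega.
Proof.
move=> kJ y [l /= lk [T [Tk _] [a an <-]]].
have [_ /(_ _ Tk)[_ sub]] := Tri_elements kJ.
by apply: sub; exists a => //; exact: lf_nodes_in an.
Qed.

End Grid.

(** * Nodes and modified functions *)

Section Modified.
Variables (R : realType) (n N : nat) (x : 'I_N -> 'rV[R]_n).
Variable ph : 'I_N -> 'rV[R]_n -> R.

Lemma nonhangingP i j : ~~ hanging x ph i -> j != i -> ph j (x i) = 0.
Proof.
move=> /existsPn /(_ j); rewrite negb_and !negbK => /orP[/eqP -> /eqP //|/eqP //].
Qed.

(** The function of its parent does not vanish at a child. *)
Lemma Htilde_hanging i a b j : j \in Htilde x ph i a b -> hanging x ph j.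
Proof.
rewrite mem_filter => /andP[_]; rewrite mem_filter => /andP[/andP[ji phj] _].
by apply/existsP; exists (last i (entry x ph i a.-1 b)); rewrite phj eq_sym ji.
Qed.

Lemma modified_nonhanging i j : ~~ hanging x ph i -> ~~ hanging x ph j ->
  modified x ph j (x i) = ph j (x i).
Proof.
move=> ni nj; rewrite /modified (negPf nj); case: ifP => // _.
rewrite big1 ?addr0// => a _; rewrite big1// => b _.
rewrite big_seq big1// => h hH; rewrite (nonhangingP ni) ?mulr0//.
by apply: contraNneq ni => <-; exact: Htilde_hanging hH.
Qed.

End Modified.

Section LocalSpace.
Variables (R : realType) (r : nat) (F : lagrange_family R r).

Lemma lf_space_cst1 s : exists2 u, lf_space F s u & u = fun=> 1.
Proof.
exists (poly3 r (fun i j l => (i + j + l == 0)%N%:R)).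
  by apply: lf_total_degree => i j l; case: (i + j + l)%N.
apply/funext => p; rewrite /poly3 big_ord_recl [X in _ + X]big1; last first.
  move=> i _; rewrite big1// => j _; rewrite big1// => l _; rewrite !mul0r//.
rewrite big_ord_recl [X in _ + X + _]big1; last first.
  by move=> i _; rewrite big1// => j _; rewrite !mul0r.
rewrite big_ord_recl [X in _ + X + _ + _]big1; last by move=> i _; rewrite !mul0r.
by rewrite /= !expr0 !mulr1 !addr0.
Qed.

Lemma lf_space_sum s (I : Type) (e : seq I) (P : pred I) (p : I -> refpt R -> R) :
  (forall i, P i -> lf_space F s (p i)) ->
  lf_space F s (fun q => \sum_(i <- e | P i) p i q - 1).
Proof.
move=> Hp.
have [u su u1] := lf_space_cst1 s; rewrite {}u1 in su.
have s0 : lf_space F s (fun=> 0).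
  have := lf_linear (-1) su su; congr (lf_space _ _ _).
  by apply/funext => q; rewrite mulN1r addNr.
have ss : lf_space F s (fun q => \sum_(i <- e | P i) p i q).
  elim: e => [|i e IH].
    by under [X in lf_space _ _ X]funext => q do rewrite big_nil.
  under [X in lf_space _ _ X]funext => q do rewrite big_cons.
  case Pi: (P i) => //.
  have := lf_linear 1 (Hp _ Pi) IH; congr (lf_space _ _ _).
  by apply/funext => q; rewrite mul1r.
have := lf_linear (-1) su ss; congr (lf_space _ _ _).
by apply/funext => q; rewrite mulN1r addrC.
Qed.

End LocalSpace.

Section NodalBasis.
Variables (R : realType) (n : nat) (Omega : set 'rV[R]_n) (J : nat).
Variables (Theta : nat -> set 'rV[R]_n) (Tri : nat -> set (element R n)).
Hypothesis grid : refined_grid Omega J Theta Tri.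
Variables (r : nat) (F : lagrange_family R r) (k : nat) (hk : (k <= J)%N).
Variables (N : nat) (x : 'I_N -> 'rV[R]_n) (phi : 'I_N -> nat -> 'rV[R]_n -> R).
Hypothesis x_inj : injective x.
Hypothesis x_nodes : range x = X_all F Theta Tri k.
Hypothesis phi_nodal : forall l i, (l <= k)%N -> X_lev F Theta Tri k l (x i) ->
  nodal_basis_function F Theta Tri k l (x i) (phi i l).

(** On an element containing y, the sum minus 1 comes from the local space and
    vanishes at all nodes, since exactly one nodal function is 1 there. *)
Lemma sum_nodal_basis l y : (l <= k)%N -> Omega_lev Theta k l y ->
  \sum_(j < N | `[< X_lev F Theta Tri k l (x j) >]) phi j l y = 1.
Proof.
move=> lk yl; have [T TT [q qc <-]] := Tri_lev_covers grid lk hk yl.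
pose P j := `[< X_lev F Theta Tri k l (x j) >].
have /choice[p pP] : forall j, exists p, P j ->
    lf_space F (el_type T) p /\
    forall a, ref_cell (el_type T) a -> phi j l (geom_map T a) = p a.
  move=> j; have [Pj|nPj] := boolP (P j); last by exists (fun=> 0).
  have [[_ /(_ _ TT)[p pT pa]] _] := phi_nodal lk (asboolW Pj).
  by exists p.
have pS j : P j -> lf_space F (el_type T) (p j) by move=> /pP[].
apply/eqP; rewrite -subr_eq0; apply/eqP.
under eq_bigr => j /pP[_ pj] do rewrite pj//.
apply: lf_unisolvent (lf_space_sum (index_enum 'I_N) pS) _ _ qc => a aT.
have ac := lf_nodes_in aT.
have Xa : X_lev F Theta Tri k l (geom_map T a) by exists T => //; exists a.
have [j _ xj] : range x (geom_map T a) by rewrite x_nodes; exists l.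
have Pj : P j by apply/asboolP; rewrite xj.
have vals h : P h -> p h a = (j == h)%:R.
  move=> Ph; have [_ <-//] := pP _ Ph.
  by have [_ ->//] := phi_nodal lk (asboolW Ph); rewrite -xj (inj_eq x_inj).
rewrite (bigD1 j)//= big1 => [|h /andP[Ph hj]]; rewrite vals//.
  by rewrite eqxx addr0 subrr.
by rewrite eq_sym (negPf hj).
Qed.

Let ph i := disc_basis F Theta Tri k (x i) (phi i).

(** If x_i were not a node of the level it lies on, then phi_i(x_i) would be 0
    like all the other phi_j(x_i), against [sum_nodal_basis]. *)
Lemma disc_basis_nonhanging i : ~~ hanging x ph i -> ph i (x i) = 1.
Proof.
move=> ni.
have Oi : Omega (x i).
  by apply: (X_all_sub grid hk (F := F)); rewrite -x_nodes; exists i.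
have [gk yg] := level_ofP grid hk Oi; set g := level_of _ _ _ in gk yg.
have phE j : ph j (x i) =
  if `[< X_lev F Theta Tri k g (x j) >] then phi j g (x i) else 0 by [].
have [Xi|nXi] := pselect (X_lev F Theta Tri k g (x i)).
  by rewrite phE asboolT//; have [_ ->//] := phi_nodal gk Xi; rewrite eqxx.
have ph0 j : ph j (x i) = 0.
  by have [->|/(nonhangingP ni)//] := eqVneq j i; rewrite phE asboolF.
have := sum_nodal_basis gk yg; rewrite big1 => [/esym/eqP|j Xj].
  by rewrite oner_eq0.
by have := ph0 j; rewrite phE Xj.
Qed.

End NodalBasis.

Theorem lemma2p16 (R : realType) (n : nat) (hn : (1 <= n <= 3)%N)
    (Omega : set 'rV[R]_n) (J : nat)
    (Theta : nat -> set 'rV[R]_n) (Tri : nat -> set (element R n))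
    (grid : refined_grid Omega J Theta Tri)
    (r : nat) (F : lagrange_family R r)
    (k : nat) (hk : (k <= J)%N)
    (N : nat) (x : 'I_N -> 'rV[R]_n)
    (x_inj : injective x) (x_nodes : range x = X_all F Theta Tri k)
    (phi : 'I_N -> nat -> 'rV[R]_n -> R)
    (phi_nodal : forall (l : nat) (i : 'I_N), (l <= k)%N ->
       X_lev F Theta Tri k l (x i) ->
       nodal_basis_function F Theta Tri k l (x i) (phi i l)) :
  let ph := fun i : 'I_N => disc_basis F Theta Tri k (x i) (phi i) in
  let free := fun i : 'I_N => inner x ph i || master x ph i in
  forall c : 'I_N -> R,
    (forall y, Omega y ->
       \sum_(i < N | free i) c i * modified x ph i y = 0) ->
    forall i : 'I_N, free i -> c i = 0.
Proof.
move=> ph free c sum0 i fi.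
have free_nh j : free j -> ~~ hanging x ph j.
  by rewrite /free /inner /master; case: hanging; rewrite ?orbT.
have ni := free_nh i fi.
have Oi : Omega (x i).
  by apply: (X_all_sub grid hk (F := F)); rewrite -x_nodes; exists i.
have ph_i : ph i (x i) = 1.
  exact: (disc_basis_nonhanging grid hk x_inj x_nodes phi_nodal ni).
have := sum0 _ Oi; rewrite (bigD1 i)//= big1 ?addr0.
  by rewrite modified_nonhanging// ph_i mulr1.
move=> j /andP[fj ji]; rewrite modified_nonhanging ?free_nh//.
by rewrite (nonhangingP ni ji) mulr0.
Qed.
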